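(* Let $(A,\mathfrak{m})$ be an excellent normal local ring whose residue field $k=A/\mathfrak{m}$ is algebraically closed, and let $I\supset J$ be $\mathfrak{m}$-primary integrally closed ideals of $A$. Then there is a sequence of $\mathfrak{m}$-primary integrally closed ideals $$I=I_0\supset I_1\supset\ldots\supset I_l=J$$ such that $l_A(I_i/I_{i+1})=1$ for every $i$ with $0\le i\le l-1$.
   Context: $l_A(M)$ denotes the length of an $A$-module $M$. Local rings are Noetherian. If $I=J$ the sequence has $l=0$. *)

(* Defs.v *)
From HB Require Import structures.
From mathcomp Require Import all_boot all_algebra all_field.
From mathcomp Require Import boolp classical_sets.

Set Implicit Arguments.
Unset Strict Implicit.
Unset Printing Implicit Defensive.

Import GRing.Theory.
Import Quotient.

Local Open Scope ring_scope.
Local Open Scope quotient_scope.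
Local Open Scope classical_set_scope.

(* Rings are commutative and may be zero ([comPzRingType]): fibre rings and
   algebras of finite type can vanish.  An ideal is a submodule of the regular
   module, possibly the unit ideal.  Ideals are Boolean predicates, which is no
   restriction in the presence of the classical axioms of [boolp]. *)
Notation ideal R := (submodClosed R^o).

Section Quotient_module.
Variables (R : pzRingType) (M : lmodType R).

Definition submod_pred (N : submodClosed M) : {pred M} := N.

Lemma submod_pred_zmod_closed (N : submodClosed M) :
  zmod_closed (submod_pred N).
Proof. exact: GRing.subsemimod_closedB (GRing.subsemimodClosedP N). Qed.

HB.instance Definition _ (N : submodClosed M) :=
  GRing.isZmodClosed.Build M (submod_pred N) (submod_pred_zmod_closed N).

Record submod_type (N : submodClosed M) :=
  SubmodType { submod_val : M; submod_valP : submod_val \in N }.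

HB.instance Definition _ N := [isSub for @submod_val N].
HB.instance Definition _ N := [Choice of submod_type N by <:].
HB.instance Definition _ N := [SubChoice_isSubLmodule of submod_type N by <:].

Definition quotmod (N : submodClosed M) : Type := {quot (submod_pred N)}.

HB.instance Definition _ N := GRing.Zmodule.on (quotmod N).

Section Scale.
Variable N : submodClosed M.

Definition quotmod_pi (x : M) : quotmod N := \pi_({quot (submod_pred N)}) x.

Lemma quotmod_piB : {morph quotmod_pi : x y / x - y}.
Proof. by move=> x y; rewrite /quotmod_pi raddfB. Qed.

Lemma quotmod_piD : {morph quotmod_pi : x y / x + y}.
Proof. by move=> x y; rewrite /quotmod_pi raddfD. Qed.

Lemma quotmod_pi_eq x y : (quotmod_pi x == quotmod_pi y) = (x - y \in N).
Proof. by rewrite /quotmod_pi -[RHS]/(x - y \in submod_pred N) -idealrBE. Qed.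

Definition quotmod_scale (a : R) (x : quotmod N) : quotmod N :=
  quotmod_pi (a *: (repr (x : {quot (submod_pred N)}) : M)).

Lemma quotmod_reprK (x : quotmod N) :
  quotmod_pi (repr (x : {quot (submod_pred N)})) = x.
Proof. exact: reprK. Qed.

Lemma quotmod_scaleE a x : quotmod_scale a (quotmod_pi x) = quotmod_pi (a *: x).
Proof.
apply/eqP; rewrite quotmod_pi_eq -scalerBr rpredZ //.
by rewrite -quotmod_pi_eq quotmod_reprK.
Qed.

Lemma quotmod_scaleA a b x :
  quotmod_scale a (quotmod_scale b x) = quotmod_scale (a * b) x.
Proof. by rewrite -[x]quotmod_reprK !quotmod_scaleE scalerA. Qed.

Lemma quotmod_scale1 : left_id 1 quotmod_scale.
Proof. by move=> x; rewrite -[x]quotmod_reprK quotmod_scaleE scale1r. Qed.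

Lemma quotmod_scaleDr : right_distributive quotmod_scale +%R.
Proof.
move=> a x y; rewrite -[x]quotmod_reprK -[y]quotmod_reprK.
by rewrite -quotmod_piD !quotmod_scaleE scalerDr quotmod_piD.
Qed.

Lemma quotmod_scaleDl x : {morph quotmod_scale^~ x : a b / a + b}.
Proof.
move=> a b; rewrite -[x]quotmod_reprK.
by rewrite !quotmod_scaleE scalerDl quotmod_piD.
Qed.

HB.instance Definition _ := GRing.Zmodule_isLmodule.Build R (quotmod N)
  quotmod_scaleA quotmod_scale1 quotmod_scaleDr quotmod_scaleDl.
End Scale.

End Quotient_module.

Section Length.
Variables (R : pzRingType) (M : lmodType R).

Section Subquotient.
Variables N P : submodClosed M.

Definition submod_trace : {pred submod_type N} := [pred x | val x \in P].

Lemma submod_trace_closed : GRing.subsemimod_closed submod_trace.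
Proof.
split; first split.
- by rewrite inE raddf0 rpred0.
- by move=> x y; rewrite !inE raddfD; exact: rpredD.
- by move=> a x; rewrite !inE linearZ; exact: rpredZ.
Qed.

HB.instance Definition _ :=
  GRing.isSubSemiModClosed.Build R (submod_type N) submod_trace
    submod_trace_closed.

(* N / (N :&: P); this is N / P when P is contained in N. *)
Definition subquotient : lmodType R :=
  quotmod (submod_trace : submodClosed (submod_type N)).
End Subquotient.

Definition has_submod_chain (n : nat) : Prop :=
  exists N_ : nat -> submodClosed M, forall i, (i < n)%N ->
    {subset N_ i <= N_ i.+1} /\ ~ {subset N_ i.+1 <= N_ i}.

(* n is the supremum of the lengths of strict chains of submodules of M. *)
Definition module_length (n : nat) : Prop :=
  has_submod_chain n /\ forall m, has_submod_chain m -> (m <= n)%N.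

End Length.

Section Ideals.
Variable R : comPzRingType.
Implicit Types (I J p m : ideal R) (X : set R).

Definition ideal_span X : set R :=
  [set x | exists n (c g : 'I_n -> R),
             (forall i, X (g i)) /\ x = \sum_(i < n) c i * g i].

Fixpoint ideal_pow X (n : nat) : set R :=
  if n is n'.+1 then ideal_span [set a * b | a in X & b in ideal_pow X n']
  else setT.

Definition noetherian : Prop :=
  forall I, exists s : seq R, [set` I] = ideal_span [set` s].

Definition proper_id I : Prop := 1 \notin I.

Definition prime_ideal p : Prop :=
  proper_id p /\ forall x y, x * y \in p -> (x \in p) \/ (y \in p).

Definition maximal_ideal m : Prop :=
  proper_id m /\ forall I, proper_id I -> {subset m <= I} -> I =i m.

Definition local_ring m : Prop :=
  [/\ noetherian, maximal_ideal m & forall n : ideal R, maximal_ideal n -> n =i m].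

Definition radical I : set R := [set x | exists n, x ^+ n \in I].

Definition primary_ideal I : Prop :=
  proper_id I /\
  forall x y, x * y \in I -> x \notin I -> radical I y.

Definition primary_for m I : Prop := primary_ideal I /\ radical I = [set` m].

Definition integral_over_ideal I (x : R) : Prop :=
  exists (n : nat) (a : nat -> R),
    [/\ (0 < n)%N,
        forall i, (0 < i <= n)%N -> ideal_pow [set` I] i (a i) &
        x ^+ n + \sum_(1 <= i < n.+1) a i * x ^+ (n - i) = 0].

Definition integrally_closed_ideal I : Prop :=
  forall x, integral_over_ideal I x -> x \in I.

(* Strict chains p_0 < ... < p_n of primes of R. *)
Definition prime_chain (n : nat) (p_ : nat -> ideal R) : Prop :=
  (forall i, (i <= n)%N -> prime_ideal (p_ i)) /\
  (forall i, (i < n)%N ->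
     {subset p_ i <= p_ i.+1} /\ ~ {subset p_ i.+1 <= p_ i}).

Definition krull_dim (n : nat) : Prop :=
  (exists p_ : nat -> ideal R, prime_chain n p_) /\
  forall k (p_ : nat -> ideal R), prime_chain k p_ -> (k <= n)%N.

Definition prime_chain_between p (q : ideal R) (n : nat) (p_ : nat -> ideal R) :=
  [/\ prime_chain n p_, p_ 0 =i p & p_ n =i q].

Definition saturated_chain (n : nat) (p_ : nat -> ideal R) : Prop :=
  forall i r, (i < n)%N -> prime_ideal r ->
    {subset p_ i <= r} -> {subset r <= p_ i.+1} -> r =i p_ i \/ r =i p_ i.+1.

Definition catenary : Prop :=
  forall p q, prime_ideal p -> prime_ideal q -> {subset p <= q} ->
    (exists N, forall n (p_ : nat -> ideal R),
       prime_chain_between p q n p_ -> (n <= N)%N) /\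
    (forall n k (p_ q_ : nat -> ideal R),
       prime_chain_between p q n p_ -> saturated_chain n p_ ->
       prime_chain_between p q k q_ -> saturated_chain k q_ -> n = k).

Definition regular_local_ring : Prop :=
  exists m, local_ring m /\
    exists d (g : 'I_d -> R), krull_dim d /\ [set` m] = ideal_span (range g).

End Ideals.
Arguments noetherian R : clear implicits.
Arguments krull_dim R n : clear implicits.
Arguments catenary R : clear implicits.
Arguments regular_local_ring R : clear implicits.

(* Localizations, residue fields, completions and tensor products are given by
   predicates that determine them up to unique isomorphism. *)

(* f : R -> S exhibits S as R_p. *)
Definition is_localization (R S : comPzRingType) (p : ideal R)
    (f : {rmorphism R -> S}) : Prop :=
  [/\ forall s, s \notin p -> exists t, f s * t = 1,
      forall y, exists a s, s \notin p /\ y * f s = f a &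
      forall a, f a = 0 -> exists s, s \notin p /\ s * a = 0].

(* f : R -> K exhibits K as Frac (R / p). *)
Definition is_residue_field (R : comPzRingType) (K : fieldType) (p : ideal R)
    (f : {rmorphism R -> K}) : Prop :=
  (forall x, f x = 0 <-> x \in p) /\
  (forall y, exists a b, f b != 0 /\ y = f a / f b).

(* f : R -> C exhibits C as the m-adic completion of R, for m finitely
   generated: R / m^k -> C / m^k C is bijective for all k, and C is separated
   and complete for the mC-adic topology. *)
Definition is_completion (R C : comPzRingType) (m : ideal R)
    (f : {rmorphism R -> C}) : Prop :=
  let mC k := ideal_span (f @` ideal_pow [set` m] k) in
  [/\ forall k x, mC k (f x) -> ideal_pow [set` m] k x,
      forall k y, exists x, mC k (y - f x),
      forall y, (forall k, mC k y) -> y = 0 &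
      forall u : nat -> C, (forall k, mC k (u k.+1 - u k)) ->
        exists y, forall k, mC k (y - u k)].

(* The pushout property of T = B (x)_R C in commutative rings. *)
Definition is_tensor (R B C T : comPzRingType)
    (f : {rmorphism R -> B}) (g : {rmorphism R -> C})
    (i : {rmorphism B -> T}) (j : {rmorphism C -> T}) : Prop :=
  (forall x, i (f x) = j (g x)) /\
  forall (U : comPzRingType) (u : {rmorphism B -> U}) (v : {rmorphism C -> U}),
    (forall x, u (f x) = v (g x)) ->
    exists w : {rmorphism T -> U},
      [/\ w \o i =1 u, w \o j =1 v &
          forall w' : {rmorphism T -> U},
            w' \o i =1 u -> w' \o j =1 v -> w' =1 w].

Definition regular_at (R : comPzRingType) (p : ideal R) : Prop :=
  forall (S : comPzRingType) (f : {rmorphism R -> S}),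
    is_localization p f -> regular_local_ring S.

Definition regular_ring (R : comPzRingType) : Prop :=
  noetherian R /\ forall p : ideal R, prime_ideal p -> regular_at p.

Definition finite_type (R B : comPzRingType) (f : {rmorphism R -> B}) : Prop :=
  exists s : seq B, forall S : subringClosed B,
    (forall x, f x \in S) -> {subset s <= S} -> forall y, y \in S.

Definition universally_catenary (R : comPzRingType) : Prop :=
  forall (B : comPzRingType) (f : {rmorphism R -> B}),
    finite_type f -> catenary B.

(* The regular locus of Spec R is the complement of some V(a). *)
Definition open_regular_locus (R : comPzRingType) : Prop :=
  exists a : ideal R, forall p : ideal R, prime_ideal p ->
    regular_at p <-> ~ {subset a <= p}.

Definition J2_ring (R : comPzRingType) : Prop :=
  forall (B : comPzRingType) (f : {rmorphism R -> B}),
    finite_type f -> open_regular_locus B.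

(* For S local with maximal ideal m and completion C, the ring
   L (x)_S C = L (x)_{k(q)} (k(q) (x)_S C) is regular for every prime q of S
   and every finite extension L of the residue field k(q). *)
Definition geom_regular_formal_fibres (S : comPzRingType) (m : ideal S) : Prop :=
  forall (C : comPzRingType) (c : {rmorphism S -> C}), is_completion m c ->
  forall q : ideal S, prime_ideal q ->
  forall (K : fieldType) (phi : {rmorphism S -> K}), is_residue_field q phi ->
  forall (L : fieldExtType K) (T : comPzRingType)
    (i : {rmorphism L -> T}) (j : {rmorphism C -> T}),
    is_tensor (in_alg L \o phi) c i j -> regular_ring T.

Definition G_ring (R : comPzRingType) : Prop :=
  forall p : ideal R, prime_ideal p ->
  forall (S : comPzRingType) (f : {rmorphism R -> S}), is_localization p f ->
  forall m : ideal S, maximal_ideal m -> geom_regular_formal_fibres m.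

Definition excellent (R : comPzRingType) : Prop :=
  [/\ noetherian R, universally_catenary R, G_ring R & J2_ring R].

Definition normal_domain (R : idomainType) : Prop :=
  forall z : {fraction R}, integralOver (@tofrac R) z ->
    exists x : R, z = tofrac x.

(* Main.v *)
Require Import Defs.
From HB Require Import structures.
From mathcomp Require Import all_boot all_algebra all_field.
From mathcomp Require Import boolp classical_sets.

(* Let x lie in I but not in J. As x is not integral over J and A is local,
   the residue map A -> k extends to a map A[J/x] -> k killing J/x. Since k
   is algebraically closed, a maximal extension of this map to subrings of
   Frac A is a k-valued place, defined on a valuation ring W with residue
   field k. Let z in I generate I W. The elements y of I such that y/z has
   residue 0 form an ideal I', integrally closed since W is a valuation
   ring, and y |-> residue of y/z embeds I / I' in k. Moreover J is
   contained in I', because j/z = (j/x)(x/z). Iterating this terminates, as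
   A / J has finite length. *)

Import GRing.Theory.
Local Open Scope ring_scope.
Set Implicit Arguments.
Unset Strict Implicit.
Unset Printing Implicit Defensive.

(** * Subrings and ideals given by closed sets *)

Section SetSubring.
Variables (R : pzRingType) (S : set R).
Hypotheses (S1 : S 1) (SB : forall x y, S x -> S y -> S (x - y))
  (SM : forall x y, S x -> S y -> S (x * y)).

Definition set_subring_pred : {pred R} := fun x => `[< S x >].

Fact set_subring_subproof : GRing.subring_closed set_subring_pred.
Proof.
split=> [|x y|x y]; rewrite -!topredE /= /set_subring_pred.
- exact/asboolP.
- by move=> /asboolP Sx /asboolP Sy; exact/asboolP/SB.
- by move=> /asboolP Sx /asboolP Sy; exact/asboolP/SM.
Qed.

HB.instance Definition _ :=
  GRing.isSubringClosed.Build R set_subring_pred set_subring_subproof.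

Definition set_subring : subringClosed R := set_subring_pred.

Lemma set_subringE x : (x \in set_subring) <-> S x.
Proof.
rewrite -topredE /= /set_subring_pred.
by split=> [/asboolP | ?]; last exact/asboolP.
Qed.
End SetSubring.

Section SetIdeal.
Variables (R : comPzRingType) (S : set R).
Hypotheses (S0 : S 0) (SD : forall x y, S x -> S y -> S (x + y))
  (SZ : forall a x, S x -> S (a * x)).

Definition set_ideal_pred : {pred R^o} := fun x => `[< S x >].

Fact set_ideal_subproof : GRing.subsemimod_closed set_ideal_pred.
Proof.
split; first split=> [|x y]; last move=> a x;
  rewrite -!topredE /= /set_ideal_pred.
- exact/asboolP.
- by move=> /asboolP Sx /asboolP Sy; exact/asboolP/SD.
- by move=> /asboolP Sx; exact/asboolP/SZ.
Qed.

HB.instance Definition _ :=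
  GRing.isSubSemiModClosed.Build R R^o set_ideal_pred set_ideal_subproof.

Definition set_ideal : ideal R := set_ideal_pred.

Lemma set_idealE x : (x \in set_ideal) <-> S x.
Proof.
rewrite -topredE /= /set_ideal_pred.
by split=> [/asboolP | ?]; last exact/asboolP.
Qed.
End SetIdeal.

(** * Extension of partial homomorphisms to places *)

Section Places.
Variables K k : fieldType.
Local Notation KK := (K * k)%type.
Hypothesis k_closed : GRing.closed_field_axiom k.

Lemma closed_field_root (p : {poly k}) : size p != 1 -> exists a, root p a.
Proof.
have [->|p0] := eqVneq p 0; first by exists 0; rewrite root0.
move=> sp; pose n := (size p).-1.
have n_gt0 : (0 < n)%N.
  rewrite /n; move: sp; rewrite -size_poly_eq0 in p0.
  by case: (size p) p0 => [|[]].
(* The axiom solves monic equations with [a ^+ n] isolated, hence the sign and the division by the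
   leading coefficient. *)
have [a aP] := k_closed (fun i => - p`_i / lead_coef p) n_gt0.
exists a; apply/rootP; rewrite horner_coef.
have -> : size p = n.+1 by rewrite prednK // size_poly_gt0.
rewrite big_ord_recr /= aP mulr_sumr -big_split big1 // => i _ /=.
rewrite -/(lead_coef p) [_ * (_ * _)]mulrA [lead_coef p * _]mulrC.
by rewrite divfK ?lead_coef_eq0 // mulNr addrN.
Qed.

(* A partial map from K to k is given by its graph in K * k.  The graph of a
   homomorphism defined on a subring is a subring meeting 0 * k trivially. *)
Definition hom_graph (G : {pred KK}) := forall c, (0, c) \in G -> c = 0.

(** * Adjoining one pair to the graph of a partial homomorphism *)

Section Adjoin.
Variable G : subringClosed KK.
Hypotheses (Gfun : hom_graph G) (Gsurj : forall c, exists y, (y, c) \in G).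

Definition adjoin (u : KK) : set KK :=
  [set v | exists2 P : {poly KK}, P \is a polyOver G & v = P.[u]].

Lemma adjoin1 u : adjoin u 1.
Proof. by exists 1; rewrite ?hornerE // rpred1. Qed.

Lemma adjoinB u x y : adjoin u x -> adjoin u y -> adjoin u (x - y).
Proof.
by move=> [P PG ->] [Q QG ->]; exists (P - Q); rewrite ?hornerE // rpredB.
Qed.

Lemma adjoinM u x y : adjoin u x -> adjoin u y -> adjoin u (x * y).
Proof.
by move=> [P PG ->] [Q QG ->]; exists (P * Q); rewrite ?hornerM // rpredM.
Qed.

Lemma horner_pair (P : {poly KK}) z a :
  P.[(z, a)] = ((map_poly fst P).[z], (map_poly snd P).[a]).
Proof.
by rewrite [LHS]surjective_pairing -[LHS]/(fst _, snd _) -!horner_map.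
Qed.

(** Lifting quotients lets Euclidean division in [k[T]] be performed on polynomials over [G]. *)
Lemma lift_poly (s : {poly k}) :
  exists2 S : {poly KK}, S \is a polyOver G & map_poly snd S = s.
Proof.
have [f fP] := choice Gsurj.
have [g gG] : {g : nat -> KK | forall i, g i \in G /\ (g i).2 = s`_i}.
  by exists (fun i => (f s`_i, s`_i)).
exists (\poly_(i < size s) g i).
  apply/polyOverP => i; rewrite coef_poly; case: ifP => _; last exact: rpred0.
  by case: (gG i).
apply/polyP=> i; rewrite coef_map coef_poly; case: ltnP => [_|le_s].
  by case: (gG i).
by rewrite nth_default.
Qed.

(* The residue polynomials of the P over G vanishing at z form an ideal of
   k[T]; a common root a of it makes (z, a) adjoinable, and otherwise this
   ideal contains 1. *)
Lemma no_residue_witness z :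
    (forall a, ~ (forall c, adjoin (z, a) (0, c) -> c = 0)) ->
  exists P : {poly KK}, [/\ P \is a polyOver G, root (map_poly fst P) z &
    map_poly snd P = 1].
Proof.
move=> noa.
have noa' a : exists Q : {poly KK}, [/\ Q \is a polyOver G,
    root (map_poly fst Q) z & ~~ root (map_poly snd Q) a].
  apply: contrapT => H; apply: (noa a) => c [Q QG].
  rewrite horner_pair => -[/esym Q1 cE].
  apply/eqP; rewrite cE; apply: contrapT => /negP c0; apply: H; exists Q.
  by split => //; apply/rootP.
pose D (n : nat) := exists P : {poly KK}, [/\ P \is a polyOver G,
  root (map_poly fst P) z, map_poly snd P != 0 & size (map_poly snd P) = n].
have exD : exists n, `[< D n >].
  have [Q [QG Qz Q0]] := noa' 0; exists (size (map_poly snd Q)); apply/asboolP.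
  by exists Q; split => //; apply: contraNneq Q0 => ->; rewrite root0.
case: (ex_minnP exD) => n /asboolP[P [PG Pz P0 sP]] min_n.
have sP1 : size (map_poly snd P) = 1.
  (* Otherwise there is a root [a], and some [Q] has a residue polynomial not vanishing at [a].
     Division with remainder yields [T], whose residue polynomial is nonzero and of smaller size. *)
  apply/eqP; apply: contrapT => /negP /closed_field_root[a Pa].
  have [Q [QG Qz Qa]] := noa' a.
  have [S SG SE] := lift_poly (map_poly snd Q %/ map_poly snd P).
  pose T := Q - S * P.
  have TE : map_poly snd T = map_poly snd Q %% map_poly snd P.
    rewrite rmorphB rmorphM /= SE; apply/eqP; rewrite subr_eq addrC.
    by rewrite -divp_eq.
  have [T0|T0] := eqVneq (map_poly snd T) 0.
    move: T0; rewrite TE => /eqP; rewrite -/(dvdp _ _) => dPQ.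
    by case/negP: Qa; apply: root_dvdp dPQ _.
  have : `[< D (size (map_poly snd T)) >].
    apply/asboolP; exists T; split=> //.
      by apply: rpredB => //; apply: rpredM.
    rewrite rmorphB rmorphM /root hornerD hornerN hornerM.
    by rewrite (rootP Qz) (rootP Pz) mulr0 subrr.
  move/min_n; rewrite -sP TE leqNgt ltn_modp // P0; by [].
have /eqP/size_poly1P[c c0 Pc] := sP1.
(* The residue polynomial is a constant [c]; a lift of its inverse normalises it to 1. *)
have [y yG] := Gsurj c^-1.
exists ((y, c^-1)%:P * P); split.
- by rewrite rpredM // polyOverC.
- by rewrite rmorphM /root hornerM (rootP Pz) mulr0.
- by rewrite rmorphM /= Pc map_polyC /= -polyCM mulVf.
Qed.

Lemma mem_polyOver (P : {poly KK}) i : P \is a polyOver G -> P`_i \in G.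
Proof. by move/polyOverP. Qed.

(* Descent on degrees: if P(z) = 0 and Q(1/z) = 0, with both residue
   polynomials equal to 1 and deg Q <= deg P, then subtracting a multiple of
   the reciprocal of Q cancels the leading term of P. *)
Lemma residue_witness_dichotomy z (P Q : {poly KK}) : z != 0 ->
  P \is a polyOver G -> root (map_poly fst P) z -> map_poly snd P = 1 ->
  Q \is a polyOver G -> root (map_poly fst Q) z^-1 -> map_poly snd Q = 1 ->
  False.
Proof.
have [N] := ubnP (size P + size Q)%N; elim: N => // N IH in z P Q *.
wlog le_QP : z P Q / (size Q <= size P)%N.
  move=> W; have [|/ltnW] := leqP (size Q) (size P); first exact: W.
  rewrite addnC => le sPQ z0 PG Pz P1 QG Qz Q1.
  apply: (W z^-1 Q P) => //; rewrite ?invr_eq0 ?invrK //.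
move=> sPQ z0 PG Pz P1 QG Qz Q1.
(* A constant [R] would be the pair [(0, 1)], which [hom_graph] excludes. *)
have size_neq1 (R : {poly KK}) w : R \is a polyOver G ->
    root (map_poly fst R) w -> map_poly snd R = 1 -> (1 < size R)%N.
  move=> RG Rw R1; rewrite ltnNge; apply/negP => sR.
  have RE := size1_polyC sR.
  have := mem_polyOver 0 RG; set c := R`_0 => cG.
  have c1 : c.1 = 0.
    by move/rootP: Rw; rewrite RE map_polyC hornerC.
  have c2 : c.2 = 1.
    have := congr1 (fun p : {poly k} => p`_0) R1.
    by rewrite coef_map coef1.
  move: cG; rewrite [c]surjective_pairing c1 c2 => /Gfun /eqP.
  by rewrite oner_eq0.
have [n sP] : {n | size P = n.+2}.
  by have := size_neq1 _ _ PG Pz P1; case: (size P) => [|[|n]] // _; exists n.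
have [j sQ] : {j | size Q = j.+2}.
  by have := size_neq1 _ _ QG Qz Q1; case: (size Q) => [|[|j]] // _; exists j.
have le_jn : (j <= n)%N by move: le_QP; rewrite sP sQ.
(* The reciprocal polynomial of [Q], which vanishes at [z]. *)
pose Qr := \poly_(i < j.+2) Q`_(j.+1 - i).
have QrG : Qr \is a polyOver G.
  apply/polyOverP => i; rewrite coef_poly; case: ifP => _; last exact: rpred0.
  exact: mem_polyOver.
have coefP2 i : (P`_i).2 = (i == 0)%:R.
  by have := congr1 (fun p : {poly k} => p`_i) P1; rewrite coef_map coef1.
have coefQ2 i : (Q`_i).2 = (i == 0)%:R.
  by have := congr1 (fun p : {poly k} => p`_i) Q1; rewrite coef_map coef1.
have Qrz : root (map_poly fst Qr) z.
  apply/rootP; rewrite (horner_coef_wide _ (n := j.+2)); last first.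
    by rewrite (leq_trans (size_poly _ _)) // size_poly.
  move/rootP: Qz; rewrite (horner_coef_wide _ (n := j.+2)); last first.
    by rewrite -sQ size_poly.
  move/(congr1 ( *%R (z ^+ j.+1))); rewrite mulr0 mulr_sumr => E0.
  rewrite -[RHS]E0 (reindex_inj rev_ord_inj) /=; apply: eq_bigr => i _.
  rewrite !coef_map coef_poly subSS ltnS leq_subr /=.
  have le_i : (i <= j.+1)%N by rewrite -ltnS.
  have le_z : ((z == 0%R) + i <= j.+1)%N by rewrite (negPf z0).
  by rewrite exprVn mulrCA -expfB_cond // subKn.
(* Both products have the same coefficient in degree [n.+1]. The constant coefficient of [Q] has
   residue 1 and the leading coefficient of [P] has residue 0, so the residue polynomial is still
   1. *)
pose P' := (Q`_0)%:P * P - (P`_n.+1)%:P * 'X^(n - j) * Qr.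
have P'G : P' \is a polyOver G.
  rewrite rpredB // ?rpredM // ?polyOverC ?mem_polyOver //.
  by rewrite polyOverXn.
apply: (IH z P' Q) => //.
- have sP' : (size P' <= n.+1)%N.
    apply/leq_sizeP => i le_i.
    rewrite /P' coefB -mulrA !coefCM coefXnM coef_poly.
    have -> : (i < n - j)%N = false.
      apply/negbTE; rewrite -leqNgt (leq_trans _ le_i) //.
      by rewrite (leq_trans (leq_subr _ _)).
    move: le_i; rewrite leq_eqVlt => /orP[/eqP<-|lt_i].
      rewrite subSn ?leq_subr // subKn // ltnSn subnn mulrC; exact: subrr.
    rewrite [P`_i]nth_default ?sP // ifF ?mulr0 ?subrr //.
    by apply/negbTE; rewrite -leqNgt ltn_subRL addnS subnK.
  by rewrite ltnS in sPQ; apply: leq_trans sPQ; rewrite ltn_add2r sP.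
- rewrite /P' !rmorphB !rmorphM /root hornerD hornerN !hornerM.
  by rewrite (rootP Pz) (rootP Qrz) !mulr0 subrr.
- rewrite /P' !rmorphB !rmorphM /= !map_polyC /= coefP2 coefQ2 P1 /=.
  by rewrite polyC0 !mul0r subr0 mulr1 polyC1.
Qed.

End Adjoin.

(** * Maximal graphs and places *)

Lemma adjoin_sub (G : subringClosed KK) u x : x \in G -> adjoin G u x.
Proof. by move=> xG; exists x%:P; rewrite ?hornerC // polyOverC. Qed.

Lemma adjoin_gen (G : subringClosed KK) u : adjoin G u u.
Proof. by exists 'X; rewrite ?hornerX // polyOverX. Qed.

Lemma max_hom_graph (G0 : subringClosed KK) : hom_graph G0 ->
  exists G : subringClosed KK, [/\ {subset G0 <= G}, hom_graph G &
    forall G' : subringClosed KK, {subset G <= G'} -> hom_graph G' ->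
      {subset G' <= G}].
Proof.
move=> G0fun.
pose good (S : set KK) := [/\ {subset G0 <= S}, S 1,
  forall x y, S x -> S y -> S (x - y), forall x y, S x -> S y -> S (x * y) &
  forall c, S (0, c) -> c = 0].
have [|S [SP Smax]] := @Zorn_bigcup _ [set S | S !=set0 -> good S]%classic.
- move=> F FP Ftot [u [X FX Xu]].
  have goodF Y y : F Y -> Y y -> good Y.
    by move=> FY Yy; apply: FP => //; exists y.
  have [XG0 X1 _ _ _] := goodF _ _ FX Xu.
  have both x y : (\bigcup_(Y in F) Y)%classic x ->
      (\bigcup_(Y in F) Y)%classic y -> exists2 Y, F Y & Y x /\ Y y.
    move=> [Y FY Yx] [Z FZ Zy]; case: (Ftot _ _ FY FZ) => sub.
      by exists Z => //; split => //; apply: sub.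
    by exists Y => //; split => //; apply: sub.
  split.
  + by move=> x xG; rewrite inE; exists X => //; apply/set_mem/XG0.
  + by exists X.
  + move=> x y xF yF; have [Y FY [Yx Yy]] := both _ _ xF yF.
    by exists Y => //; case: (goodF _ _ FY Yx) => _ _ + _ _; apply.
  + move=> x y xF yF; have [Y FY [Yx Yy]] := both _ _ xF yF.
    by exists Y => //; case: (goodF _ _ FY Yx) => _ _ _ + _; apply.
  + move=> c [Y FY Yc]; by case: (goodF _ _ FY Yc) => _ _ _ _; apply.
have good0 (G : subringClosed KK) : {subset G0 <= G} -> hom_graph G ->
    good [set` G]%classic.
  move=> G0G Gfun; split=> /=.
  - by move=> x /G0G; rewrite inE.
  - exact: rpred1.
  - exact: rpredB.
  - exact: rpredM.
  - exact: Gfun.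
have S0 : (S !=set0)%classic.
  apply: contrapT => /set0P/negP; rewrite negbK => /eqP S0.
  apply: (Smax [set` G0]%classic); last by move=> _; apply: good0.
  by rewrite S0; split=> // /(_ 1 (rpred1 G0)).
have [G0S S1 SB SM Sfun] := SP S0.
exists (set_subring S1 SB SM); split.
- by move=> x /G0S /set_mem Sx; apply/set_subringE.
- by move=> c /set_subringE/Sfun.
move=> G' SG' G'fun x xG'; apply/set_subringE; apply: contrapT => Sx.
apply: (Smax [set` G']%classic).
  split; last by move/(_ _ xG').
  by move=> y Sy /=; apply: SG'; apply/set_subringE.
move=> _; apply: good0 => // y /G0S /set_mem Sy.
by apply: SG'; apply/set_subringE.
Qed.

(** For a maximal [G], an element [z] outside its domain admits no adjoinable pair, so it is a root
    of a polynomial over [G] with residue polynomial 1. This cannot happen for both [z] and [z^-1].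
    Hence the domain of [G] is a valuation ring. *)
Lemma place_extension (G0 : subringClosed KK) :
    hom_graph G0 -> (forall c, exists y, (y, c) \in G0) ->
  exists G : subringClosed KK, [/\ {subset G0 <= G}, hom_graph G &
    forall z, z != 0 ->
      (exists a, (z, a) \in G) \/ (exists a, (z^-1, a) \in G)].
Proof.
move=> G0fun G0surj.
have [G [G0G Gfun Gmax]] := max_hom_graph G0fun; exists G; split=> // z z0.
have Gsurj c : exists y, (y, c) \in G.
  by have [y /G0G] := G0surj c; exists y.
have memG w : ~ (exists a, (w, a) \in G) ->
    forall a, ~ (forall c, adjoin G (w, a) (0, c) -> c = 0).
  move=> now a fun_wa; apply: now; exists a.
  pose u := (w, a).
  pose G' := set_subring (@adjoin1 G u) (@adjoinB G u) (@adjoinM G u).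
  apply: (Gmax G').
  - by move=> x /(@adjoin_sub G (w, a) _) ?; apply/set_subringE.
  - by move=> c /set_subringE/fun_wa.
  - exact/set_subringE/adjoin_gen.
apply: contrapT => /not_orP[/memG/(no_residue_witness Gsurj)[P [PG Pz P1]]].
move=> /memG/(no_residue_witness Gsurj)[Q [QG Qz Q1]].
exact: (residue_witness_dichotomy Gfun z0 PG Pz P1 QG Qz Q1).
Qed.

End Places.

(** * Ideals in Noetherian and local rings *)

Section IdealTheory.
Variable R : comPzRingType.
Implicit Types (I J K : ideal R) (X Y : set R).

Lemma idealM I a x : x \in I -> a * x \in I.
Proof. by move=> xI; have : a *: (x : R^o) \in I by exact: rpredZ. Qed.

Lemma idealD I x y : x \in I -> y \in I -> x + y \in I.
Proof. exact: (@rpredD R^o I). Qed.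

Lemma ideal_span0 X : ideal_span X 0.
Proof.
by exists 0%N, (fun=> 0), (fun=> 0); split=> [[]//|]; rewrite big_ord0.
Qed.

Lemma ideal_span_gen X x : X x -> ideal_span X x.
Proof.
by move=> Xx; exists 1%N, (fun=> 1), (fun=> x); rewrite big_ord1 mul1r.
Qed.

Lemma ideal_spanD X x y :
  ideal_span X x -> ideal_span X y -> ideal_span X (x + y).
Proof.
move=> [n [c [g [Xg ->]]]] [n' [c' [g' [Xg' ->]]]].
exists (n + n')%N.
exists (fun i => match split i with inl j => c j | inr j => c' j end).
exists (fun i => match split i with inl j => g j | inr j => g' j end).
split=> [i|]; first by case: (split i).
rewrite big_split_ord /=; congr (_ + _); apply: eq_bigr => i _.
  by rewrite (unsplitK (inl i)).
by rewrite (unsplitK (inr i)).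
Qed.

Lemma ideal_spanZ X a x : ideal_span X x -> ideal_span X (a * x).
Proof.
move=> [n [c [g [Xg ->]]]]; exists n, (fun i => a * c i), g; split=> //.
by rewrite mulr_sumr; apply: eq_bigr => i _; rewrite mulrA.
Qed.

Lemma ideal_span_ind X (P : R -> Prop) : P 0 ->
  (forall x y, P x -> P y -> P (x + y)) -> (forall a x, X x -> P (a * x)) ->
  forall x, ideal_span X x -> P x.
Proof.
by move=> P0 PD PX x [n [c [g [Xg ->]]]]; apply: big_ind => // i _; apply: PX.
Qed.

Lemma ideal_span_sub X I : (forall x, X x -> x \in I) ->
  forall x, ideal_span X x -> x \in I.
Proof.
move=> XI; apply: ideal_span_ind; first exact: rpred0.
  exact: idealD.
by move=> a x /XI; apply: idealM.
Qed.

Lemma ideal_pow0 X n : ideal_pow X n 0.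
Proof. by case: n => // n; apply: ideal_span0. Qed.

Lemma ideal_powD X n x y : ideal_pow X n x -> ideal_pow X n y ->
  ideal_pow X n (x + y).
Proof. by case: n => // n; apply: ideal_spanD. Qed.

Lemma ideal_powZ X n a x : ideal_pow X n x -> ideal_pow X n (a * x).
Proof. by case: n => // n; apply: ideal_spanZ. Qed.

Lemma ideal_powM X i j a b : ideal_pow X i a -> ideal_pow X j b ->
  ideal_pow X (i + j) (a * b).
Proof.
elim: i a => [|i IH] a; first by move=> _; apply: ideal_powZ.
move=> + Xb; rewrite addSn.
move: a; apply: ideal_span_ind.
- by rewrite mul0r; apply: ideal_pow0.
- by move=> x y ? ?; rewrite mulrDl; apply: ideal_powD.
move=> c _ [x Xx [y Xy <-]]; rewrite -!mulrA.
apply: ideal_powZ; apply: ideal_span_gen; exists x => //; exists (y * b) => //.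
exact: IH.
Qed.

Lemma ideal_pow1 X x : X x -> ideal_pow X 1 x.
Proof.
by move=> Xx; apply: ideal_span_gen; exists x => //; exists 1; rewrite ?mulr1.
Qed.

Lemma ideal_powS X Y n x : (X `<=` Y)%classic ->
  ideal_pow X n x -> ideal_pow Y n x.
Proof.
move=> XY; elim: n x => // n IH; apply: ideal_span_ind.
- exact: ideal_span0.
- exact: ideal_spanD.
move=> a _ [x Xx [y Xy <-]]; apply: ideal_spanZ; apply: ideal_span_gen.
by exists x; [apply: XY | exists y => //; apply: IH].
Qed.

Lemma integral_over_idealS I J x : {subset I <= J} ->
  integral_over_ideal I x -> integral_over_ideal J x.
Proof.
move=> IJ [n [a [n0 aI aE]]]; exists n, a; split=> // i /aI.
exact: ideal_powS.
Qed.

Definition ideal_adjoin I (y : R) : ideal R.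
Proof.
apply: (@set_ideal R
  [set x | exists2 u, u \in I & exists a, x = u + a * y]%classic).
- by exists 0; [apply: rpred0 | exists 0; rewrite mul0r addr0].
- move=> _ _ [u uI [a ->]] [v vI [b ->]].
  by exists (u + v); [apply: idealD | exists (a + b); rewrite mulrDl addrACA].
- move=> c _ [u uI [a ->]]; exists (c * u); first exact: idealM.
  by exists (c * a); rewrite mulrDr mulrA.
Defined.

Lemma ideal_adjoinP I y x :
  x \in ideal_adjoin I y <-> exists2 u, u \in I & exists a, x = u + a * y.
Proof. exact: set_idealE. Qed.

Lemma ideal_adjoin_gen I y : y \in ideal_adjoin I y.
Proof.
apply/ideal_adjoinP; exists 0; first exact: rpred0.
by exists 1; rewrite add0r mul1r.
Qed.

Lemma ideal_adjoin_sub I y : {subset I <= ideal_adjoin I y}.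
Proof.
move=> x xI; apply/ideal_adjoinP; exists x => //.
by exists 0; rewrite mul0r addr0.
Qed.

Lemma ideal_adjoin_min I K y : {subset I <= K} -> y \in K ->
  {subset ideal_adjoin I y <= K}.
Proof.
by move=> IK yK x /ideal_adjoinP[u /IK uK [a ->]]; rewrite idealD // idealM.
Qed.

(** * Noetherian induction and units of local rings *)

Lemma not_subset I J : ~ {subset I <= J} -> exists2 x, x \in I & x \notin J.
Proof.
move=> nIJ; apply: contrapT => H; apply: nIJ => x xI.
by apply: contrapT => /negP xJ; apply: H; exists x.
Qed.

(** By choice, a counterexample would start a strictly ascending sequence of counterexamples; its
    union is finitely generated, so the sequence stabilises. *)
Lemma noetherian_ind (P : ideal R -> Prop) : noetherian R ->
  (forall I, (forall J, {subset I <= J} -> ~ {subset J <= I} -> P J) -> P I) ->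
  forall I, P I.
Proof.
move=> noeth step I0; apply: contrapT => nP0.
pose T := {I : ideal R | ~ P I}.
have next (t : T) : exists t' : T, {subset sval t <= sval t'} /\
    ~ {subset sval t' <= sval t}.
  case: t => I nPI /=; apply: contrapT => H; apply: nPI.
  apply: step => J IJ nJI.
  by apply: contrapT => nPJ; apply: H; exists (exist _ J nPJ).
have [f fP] := choice next.
pose u n : ideal R := sval (iter n f (exist _ I0 nP0)).
have uS n : {subset u n <= u n.+1} by case: (fP (iter n f (exist _ I0 nP0))).
have umono i j : (i <= j)%N -> {subset u i <= u j}.
  move=> /subnK <-; elim: (j - i)%N => // d IH x /IH; rewrite addSn; exact: uS.
have U0 : exists n, 0 \in u n by exists 0%N; apply: rpred0.
have UD x y : (exists n, x \in u n) -> (exists n, y \in u n) ->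
    exists n, x + y \in u n.
  move=> [i xi] [j yj]; exists (maxn i j); rewrite idealD //.
    by apply: umono xi; apply: leq_maxl.
  by apply: umono yj; apply: leq_maxr.
have UZ a x : (exists n, x \in u n) -> exists n, a * x \in u n.
  by move=> [i xi]; exists i; apply: idealM.
pose U := set_ideal (S := [set x | exists n, x \in u n]%classic) U0 UD UZ.
have UE x : x \in U <-> exists n, x \in u n by exact: set_idealE.
have [s sE] := noeth U.
have [N sN] : exists N, {subset s <= u N}.
  have : forall x, x \in s -> exists n, x \in u n.
    move=> x xs; apply/UE.
    suff: ([set` U] x)%classic by [].
    by rewrite sE; apply: ideal_span_gen.
  elim: {sE} s => [|x s IH] sU; first by exists 0%N.
  have [i xi] := sU x (mem_head _ _).
  have [|j sj] := IH; first by move=> y ys; apply: sU; rewrite inE ys orbT.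
  exists (maxn i j) => y; rewrite inE => /orP[/eqP->|/sj yj].
    by apply: umono xi; apply: leq_maxl.
  by apply: umono yj; apply: leq_maxr.
have [_] := fP (iter N f (exist _ I0 nP0)); apply.
move=> x xN; apply: (ideal_span_sub (X := [set` s]%classic)); first exact: sN.
by rewrite -sE /=; apply/UE; exists N.+1.
Qed.

Lemma exists_maximal_ideal I : noetherian R -> proper_id I ->
  exists2 n : ideal R, maximal_ideal n & {subset I <= n}.
Proof.
move=> noeth; move: I; apply: (noetherian_ind noeth) => I IH I1.
have [maxI|nmaxI] := pselect (maximal_ideal I); first by exists I.
have [J [J1 IJ nJI]] : exists J, [/\ proper_id J, {subset I <= J} &
    ~ {subset J <= I}].
  apply: contrapT => H; apply: nmaxI; split=> // J J1 IJ x.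
  apply/idP/idP => [xJ|/IJ//]; apply: contrapT => xI; apply: H.
  by exists J; split=> // /(_ x xJ).
by have [n maxn Jn] := IH J IJ nJI J1; exists n => // x /IJ/Jn.
Qed.

(** Without an inverse, [x] would generate a proper ideal, contained in a maximal one, and that is
    [m]. *)
Lemma local_ring_unit (m : ideal R) x :
  local_ring m -> x \notin m -> exists y, y * x = 1.
Proof.
move=> [noeth _ uniq] xm; apply: contrapT => nunit.
have P0 : exists a, a * x = 0 by exists 0; rewrite mul0r.
have PD u v : (exists a, a * x = u) -> (exists a, a * x = v) ->
    exists a, a * x = u + v.
  by move=> [a <-] [b <-]; exists (a + b); rewrite mulrDl.
have PZ c u : (exists a, a * x = u) -> exists a, a * x = c * u.
  by move=> [a <-]; exists (c * a); rewrite mulrA.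
pose P := set_ideal (S := [set u | exists a, a * x = u]%classic) P0 PD PZ.
have PE u : u \in P <-> exists a, a * x = u by exact: set_idealE.
have [|n maxn xn] := @exists_maximal_ideal P noeth.
  by apply/negP => /PE.
case/negP: xm; rewrite -(uniq n maxn); apply/xn/PE.
by exists 1; rewrite mul1r.
Qed.

(** The elements of [s] are treated one at a time: the previous witness is multiplied by the highest
    power of [g] that keeps it outside [J]. For generators of [m], the result spans a socle line
    modulo [J]. *)
Lemma ideal_socle J (s : seq R) : proper_id J ->
    (forall g, g \in s -> exists n, g ^+ n \in J) ->
  exists2 y : R, y \notin J & forall g, g \in s -> g * y \in J.
Proof.
move=> J1; elim: s => [|g s IH] sJ; first by exists 1.
have [|y yJ sy] := IH; first by move=> h hs; apply: sJ; rewrite inE hs orbT.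
have [N gN] := sJ g (mem_head _ _).
have exn : exists n, g ^+ n * y \in J by exists N; rewrite mulrC idealM.
case: (ex_minnP exn) => -[|n] gn min_n.
  by rewrite expr0 mul1r (negPf yJ) in gn.
exists (g ^+ n * y).
  by apply/negP => /min_n; rewrite ltnn.
move=> h; rewrite inE => /orP[/eqP->|/sy hy]; first by rewrite mulrA -exprS.
by rewrite mulrCA idealM.
Qed.
End IdealTheory.

(** A substitute for the length of [K / J], recording only what makes a descent of ideals above [J]
    terminate. *)
Definition strictly_monotone_above (R : comPzRingType) (J : ideal R)
    (r : ideal R -> nat) :=
  forall K K' : ideal R, {subset J <= K'} -> {subset K' <= K} ->
    (r K' <= r K)%N /\ (~ {subset K <= K'} -> (r K' < r K)%N).

(* Induction from J to J + (y), where y spans a socle line of R / J; this line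
   contributes 1 to the rank of exactly those ideals which contain y. *)
Lemma exists_rank (R : comPzRingType) (m J : ideal R) : local_ring m ->
    (forall x, x \in m -> exists n, x ^+ n \in J) ->
  exists r, strictly_monotone_above J r.
Proof.
move=> locm; have [noeth _ _] := locm.
have [s sE] := noeth m.
move: J; apply: (noetherian_ind noeth) => J IH mJ.
have [J1|J1] := boolP (1 \in J).
  exists (fun=> 0%N) => K K' JK' _; split=> //; case.
  by move=> x _; rewrite -[x]mulr1 idealM // JK'.
have [y yJ sy] : exists2 y : R, y \notin J & forall g, g \in s -> g * y \in J.
  apply: ideal_socle => // g gs; apply: mJ.
  suff: ([set` m] g)%classic by [].
  by rewrite sE; apply: ideal_span_gen.
have my a : a \in m -> a * y \in J.
  move=> am; have : ([set` m] a)%classic by [].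
  rewrite sE; move: {am} a; apply: ideal_span_ind.
  - by rewrite mul0r; apply: rpred0.
  - by move=> a b ? ?; rewrite mulrDl idealD.
  - by move=> c g /sy gy; rewrite -mulrA idealM.
have [|||r rP] := IH (ideal_adjoin J y).
- exact: ideal_adjoin_sub.
- by move/(_ _ (ideal_adjoin_gen J y)); rewrite (negPf yJ).
- by move=> x /mJ[n xn]; exists n; apply: ideal_adjoin_sub.
exists (fun K => (r (ideal_adjoin K y) + (y \in K))%N) => K K' JK' K'K.
have yK'K : ((y \in K') <= (y \in K))%N.
  by case: (boolP (y \in K')) => // /K'K ->.
have [||le_r lt_r] := rP (ideal_adjoin K y) (ideal_adjoin K' y).
- apply: ideal_adjoin_min; last exact: ideal_adjoin_gen.
  by move=> x /JK'; apply: ideal_adjoin_sub.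
- apply: ideal_adjoin_min; last exact: ideal_adjoin_gen.
  by move=> x /K'K; apply: ideal_adjoin_sub.
split; first exact: leq_add le_r yK'K.
(* If [K] and [K'] still differ after adjoining [y], the first summand drops. Otherwise the second
   must drop: [y] lies in [K] but not in [K']. *)
move=> nKK'; have [KyK'y|/lt_r lt] :=
    pselect {subset ideal_adjoin K y <= ideal_adjoin K' y}; last first.
  by rewrite -addSn; exact: leq_add lt yK'K.
have KK'y x : x \in K -> exists2 u, u \in K' & exists a, x = u + a * y.
  by move=> xK; apply/ideal_adjoinP/KyK'y/ideal_adjoin_sub.
have [yK'|yK'] := boolP (y \in K').
  by case: nKK' => x /KK'y[u uK' [a ->]]; rewrite idealD // idealM.
have [yK|yK] := boolP (y \in K).
  by rewrite addn0 addn1 ltnS.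
(* With [y] outside [K], write [x = u + a * y]. If [a] lies in [m], then [a * y] lies in [J] and [x]
   in [K']; if [a] is a unit, then [y] lies in [K], a contradiction. *)
case: nKK' => x xK; have [u uK' [a xE]] := KK'y x xK.
have [am|am] := boolP (a \in m).
  by rewrite xE idealD // JK' // my.
have [b ba] := local_ring_unit locm am.
case/negP: yK; have -> : y = b * (x + (-1) * u).
  by rewrite xE mulN1r addrAC subrr add0r mulrA ba mul1r.
by rewrite idealM // idealD // idealM // K'K.
Qed.

(** * Modules of length one *)

Lemma module_length1 (R : pzRingType) (M : lmodType R) :
    (exists x : M, x != 0) ->
    (forall x y : M, x != 0 -> exists a, y = a *: x) ->
  module_length M 1.
Proof.
move=> [x0 x0_neq0] gen.
have sub (N : submodClosed M) x : x \in N -> x != 0 -> forall y, y \in N.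
  by move=> xN /gen xgen y; have [a ->] := xgen y; apply: rpredZ.
split.
  pose z : {pred M} := pred1 0.
  have z_closed : GRing.subsemimod_closed z.
    split; first split=> [|x y]; last move=> a x; rewrite ?inE //.
      by move=> /eqP-> /eqP->; rewrite addr0.
    by move=> /eqP->; rewrite scaler0.
  have t_closed : GRing.subsemimod_closed (predT : {pred M}) by [].
  pose Z : submodClosed M :=
    HB.pack z (GRing.isSubSemiModClosed.Build R M z z_closed).
  pose T : submodClosed M :=
    HB.pack (predT : {pred M})
      (GRing.isSubSemiModClosed.Build R M (predT : {pred M}) t_closed).
  exists (fun i => if i is 0%N then Z else T) => -[|//] _; split=> //.
  by move/(_ x0 isT); apply/negP.
move=> [|[|n]] // [N NP].
have [_ n10] := NP 0%N isT; have [_ n21] := NP 1%N isT.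
(* An element of [N 1] outside [N 0] is nonzero, so it generates the module and leaves no room for
   [N 2]. *)
exfalso; apply: n21 => y _; apply: contrapT => yN; apply: n10 => x xN.
have [->|x0'] := eqVneq x 0; first exact: rpred0.
by case: yN; apply: sub xN x0' _.
Qed.

(** The second hypothesis expresses, on representatives, that each nonzero class generates; later
    arguments can thus stay inside the ring. *)
Lemma subquotient_length1 (R : comPzRingType) (I J : ideal R) :
    ~ {subset I <= J} ->
    (forall u v, u \in I -> v \in I -> u \notin J ->
      exists a, v - a * u \in J) ->
  module_length (subquotient I J) 1.
Proof.
move=> nIJ gen; pose pi := @quotmod_pi R (submod_type I) (submod_trace J).
have pi_eq (x y : submod_type I) : (pi x == pi y) = (val x - val y \in J).
  by rewrite quotmod_pi_eq inE raddfB.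
have pi_eq0 (x : submod_type I) : (pi x == 0) = (val x \in J).
  have -> : 0 = pi 0 by apply/eqP; rewrite /pi /quotmod_pi raddf0.
  by rewrite pi_eq -raddfB subr0.
apply: module_length1.
  have [x xI xJ] := not_subset nIJ.
  by exists (pi (SubmodType xI)); rewrite pi_eq0.
move=> x y; rewrite -[x]quotmod_reprK -[y]quotmod_reprK -!/(pi _).
move: (repr _) (repr _) => v u; rewrite pi_eq0 => uJ.
have [a aJ] := gen (val u) (val v) (submod_valP u) (submod_valP v) uJ.
exists a; apply/eqP; have -> : a *: pi u = pi (a *: u) by exact: quotmod_scaleE.
rewrite pi_eq; have -> : \val (a *: u) = a *: (\val u : R^o) by exact: linearZ.
exact: aJ.
Qed.

(** * Cutting an integrally closed ideal by a place *)

Section Step.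
Variables (A : idomainType) (m : ideal A) (k : fieldType)
  (res : {rmorphism A -> k}).
Hypotheses (locm : local_ring m) (resm : is_residue_field m res).
Implicit Types I J : ideal A.

Local Notation F := {fraction A}.
Local Notation FF := ({fraction A} * k)%type.
Local Notation frac := (@tofrac A).

Lemma res_eq0 x : (res x == 0) = (x \in m).
Proof. by have [+ _] := resm; move=> /(_ x) [? ?]; apply/eqP/idP. Qed.

(** The residue field is given by fractions of residues; a denominator with nonzero residue is
    already a unit of [A]. *)
Lemma res_surj c : exists a, res a = c.
Proof.
have [_ /(_ c) [a [b [b0 ->]]]] := resm.
rewrite res_eq0 in b0; have [b' bb'] := local_ring_unit locm b0.
exists (a * b'); rewrite rmorphM; congr (_ * _).
have rb0 : res b != 0 by rewrite res_eq0.
by apply: (mulIf rb0); rewrite mulVf // -rmorphM bb' rmorph1.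
Qed.

(* The graph of the map A[J/x] -> k which extends res and kills J/x, where
   A[J/x] consists of the values at 1/x of the elements of the Rees algebra. *)
Definition rees_graph J x : set FF :=
  [set v | exists2 p : {poly A}, forall i, ideal_pow [set` J] i p`_i &
     v = ((map_poly frac p).[(frac x)^-1], res p`_0)]%classic.

Lemma rees_graphC J x a : rees_graph J x (frac a, res a).
Proof.
exists a%:P; last by rewrite map_polyC hornerC coefC.
by case=> [|i] //; rewrite coefC; apply: ideal_pow0.
Qed.

Lemma rees_graphB J x u v :
  rees_graph J x u -> rees_graph J x v -> rees_graph J x (u - v).
Proof.
move=> [p pJ ->] [q qJ ->]; exists (p - q).
  move=> i; rewrite coefB -[- _]mulN1r; apply: ideal_powD => //.
  exact: ideal_powZ.
by rewrite rmorphB !hornerE coefB rmorphB.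
Qed.

Lemma rees_graphM J x u v :
  rees_graph J x u -> rees_graph J x v -> rees_graph J x (u * v).
Proof.
move=> [p pJ ->] [q qJ ->]; exists (p * q).
  move=> i; rewrite coefM; apply: big_ind => [||j _].
  - exact: ideal_pow0.
  - exact: ideal_powD.
  by have := ideal_powM (pJ j) (qJ (i - j)%N); rewrite subnKC // -ltnS.
by rewrite rmorphM hornerM coefM big_ord1 rmorphM.
Qed.

Lemma rees_graph1 J x : rees_graph J x 1.
Proof. by have := rees_graphC J x 1; rewrite !rmorph1. Qed.

Lemma rees_graph_div J x j : j \in J -> rees_graph J x (frac j / frac x, 0).
Proof.
move=> jJ; exists (j *: 'X).
  case=> [|[|i]]; rewrite coefZ coefX ?mulr0 ?mulr1 //.
  - exact: ideal_pow1.
  - exact: ideal_pow0.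
by rewrite linearZ /= map_polyX !hornerE coefZ coefX mulr0 rmorph0.
Qed.

(** Were the residue nonzero, the constant coefficient of [p] would be a unit. Dividing the relation
    p(1/x) = 0 by it and clearing denominators would make [x] integral over [J]. *)
Lemma rees_graph_fun J x : integrally_closed_ideal J -> x \notin J ->
  forall c, rees_graph J x (0, c) -> c = 0.
Proof.
move=> Jcl xJ c [p pJ [p1 ->]]; apply/eqP; rewrite res_eq0.
have x0 : x != 0 by apply: contraNneq xJ => ->; apply: rpred0.
have fx0 : frac x != 0 by rewrite tofrac_eq0.
apply: contrapT => /negP p0m; case/negP: xJ; apply: Jcl.
have [b bp0] := local_ring_unit locm p0m.
(* The degree is the maximum of 1 and [size p]: it must be positive even for constant [p], and
   coefficients beyond the size vanish. *)
exists (size p).-1.+1, (fun i => b * p`_i); split=> //.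
  by move=> i _; apply: ideal_powZ.
set n := (size p).-1.+1.
have pn : (size (map_poly frac p) <= n.+1)%N.
  by rewrite (leq_trans (size_poly _ _)) // /n; case: (size p).
apply/eqP; rewrite -tofrac_eq0; apply/eqP.
have E : x ^+ n + \sum_(1 <= i < n.+1) b * p`_i * x ^+ (n - i)
   = b * \sum_(i < n.+1) p`_i * x ^+ (n - i).
  rewrite big_ord_recl mulrDr subn0 mulrA bp0 mul1r; congr (_ + _).
  rewrite big_add1 /= big_mkord mulr_sumr; apply: eq_bigr => i _.
  by rewrite mulrA.
rewrite E rmorphM rmorph_sum /=.
suff -> : \sum_(i < n.+1) frac (p`_i * x ^+ (n - i)) = 0 by rewrite mulr0.
transitivity (frac x ^+ n * (map_poly frac p).[(frac x)^-1]); last first.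
  by rewrite -p1 mulr0.
rewrite (horner_coef_wide _ pn) mulr_sumr; apply: eq_bigr => i _.
rewrite coef_map rmorphM rmorphXn mulrCA; congr (_ * _).
have le_i : ((frac x == 0%R) + i <= n)%N.
  by rewrite (negPf fx0); have := ltn_ord i; rewrite ltnS; apply.
by rewrite exprVn -expfB_cond.
Qed.

(** * The ideal cut out of [I] by a place extending the residue map *)

Section Cut.
Variables (G : subringClosed FF).
Hypotheses (Gfun : hom_graph G) (GA : forall a, (frac a, res a) \in G)
  (Gval : forall z, z != 0 ->
     (exists a, (z, a) \in G) \/ (exists a, (z^-1, a) \in G)).

Lemma graph_eq (w : F) (a b : k) : (w, a) \in G -> (w, b) \in G -> a = b.
Proof.
move=> wa wb; apply/eqP; rewrite -subr_eq0; apply/eqP/Gfun.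
by have := rpredB wa wb; rewrite -[_ - _]/(w - w, a - b) subrr.
Qed.

Lemma graphM (u v : F) (a b : k) :
  (u, a) \in G -> (v, b) \in G -> (u * v, a * b) \in G.
Proof. by move=> ua vb; have := rpredM ua vb. Qed.

Lemma graphB (u v : F) (a b : k) :
  (u, a) \in G -> (v, b) \in G -> (u - v, a - b) \in G.
Proof. by move=> ua vb; have := rpredB ua vb. Qed.

Lemma graphD (u v : F) (a b : k) :
  (u, a) \in G -> (v, b) \in G -> (u + v, a + b) \in G.
Proof. by move=> ua vb; have := rpredD ua vb. Qed.

Lemma graph0 : (0, 0) \in G.
Proof. exact: (rpred0 G). Qed.

(** Of two nonzero elements, one divides the other in the valuation ring; running through the list
    retains an element [z] of least value. *)
Lemma graph_min_seq (s : seq A) : (forall y, y \in s -> y = 0) \/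
  exists z, [/\ z \in s, z != 0 &
    forall y, y \in s -> exists a, (frac y / frac z, a) \in G].
Proof.
elim: s => [|g s IH]; first by left.
have [->|g0] := eqVneq g 0.
  case: IH => [s0|[z [zs z0 sz]]].
    by left=> y; rewrite inE => /orP[/eqP//|/s0].
  right; exists z; split=> // [|y]; first by rewrite inE zs orbT.
  rewrite inE => /orP[/eqP->|/sz//].
  by exists 0; rewrite rmorph0 mul0r; apply: graph0.
have fg0 : frac g != 0 by rewrite tofrac_eq0.
have gg : (frac g / frac g, 1) \in G by rewrite divff //; apply: (rpred1 G).
case: IH => [s0|[z [zs z0 sz]]].
  right; exists g; split; rewrite ?mem_head // => y.
  rewrite inE => /orP[/eqP->|/s0->]; first by exists 1.
  by exists 0; rewrite rmorph0 mul0r; apply: graph0.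
have fz0 : frac z != 0 by rewrite tofrac_eq0.
have gz0 : frac g / frac z != 0 by rewrite mulf_neq0 // invr_eq0.
have [[c gz]|[c zg]] := Gval gz0.
  right; exists z; split=> // [|y]; first by rewrite inE zs orbT.
  by rewrite inE => /orP[/eqP->|/sz//]; exists c.
rewrite invf_div in zg.
right; exists g; split; rewrite ?mem_head // => y.
rewrite inE => /orP[/eqP->|/sz[a ya]]; first by exists 1.
exists (a * c); have := graphM ya zg.
by rewrite mulrA divfK.
Qed.

(** A generator of least value serves for all of [I], because [GA] places [A] inside the valuation
    ring. *)
Lemma graph_min_ideal I x : x \in I -> x != 0 -> exists z, [/\ z \in I, z != 0 &
    forall y, y \in I -> exists a, (frac y / frac z, a) \in G].
Proof.
move=> xI x0; have [noeth _ _] := locm; have [s sE] := noeth I.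
have sI y : y \in s -> y \in I.
  move=> ys; suff: ([set` I] y)%classic by [].
  by rewrite sE; apply: ideal_span_gen.
have Is (P : A -> Prop) : P 0 -> (forall u v, P u -> P v -> P (u + v)) ->
    (forall a u, u \in s -> P (a * u)) -> forall y, y \in I -> P y.
  move=> P0 PD PZ y yI; have : ([set` I] y)%classic by [].
  by rewrite sE; move: y {yI}; apply: ideal_span_ind.
case: (graph_min_seq s) => [s0|[z [zs z0 sz]]].
  case/eqP: x0; move: x xI; apply: Is => // [u v -> ->|a u /s0 ->].
    by rewrite addr0.
  by rewrite mulr0.
exists z; split=> //; first exact: sI.
apply: Is.
- by exists 0; rewrite rmorph0 mul0r; apply: graph0.
- move=> u v [a ua] [b vb]; exists (a + b).
  by rewrite rmorphD mulrDl; apply: graphD.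
- move=> c u /sz[a ua]; exists (res c * a).
  by rewrite rmorphM -mulrA; apply: (graphM (GA c) ua).
Qed.

Variables (I : ideal A) (z : A).
Hypotheses (zI : z \in I) (z0 : z != 0)
  (Iz : forall y, y \in I -> exists a, (frac y / frac z, a) \in G).

(** This is the intersection of [I] with [z] times the maximal ideal of the valuation ring. *)
Definition cut_set : set A :=
  [set y | y \in I /\ (frac y / frac z, 0) \in G]%classic.

Fact cut0 : cut_set 0.
Proof. by split; [apply: rpred0 | rewrite rmorph0 mul0r; apply: graph0]. Qed.

Fact cutD x y : cut_set x -> cut_set y -> cut_set (x + y).
Proof.
move=> [xI xz] [yI yz]; split; first exact: idealD.
by have := graphD xz yz; rewrite addr0 -mulrDl -rmorphD.
Qed.

Fact cutZ a x : cut_set x -> cut_set (a * x).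
Proof.
move=> [xI xz]; split; first exact: idealM.
by have := graphM (GA a) xz; rewrite mulr0 mulrA -rmorphM.
Qed.

Definition cut : ideal A := set_ideal cut0 cutD cutZ.

Lemma cutP y : y \in cut <-> y \in I /\ (frac y / frac z, 0) \in G.
Proof. exact: set_idealE. Qed.

Lemma cut_sub : {subset cut <= I}.
Proof. by move=> y /cutP[]. Qed.

Lemma cut_proper : ~ {subset I <= cut}.
Proof.
move/(_ z zI)/cutP=> [_]; rewrite divff ?tofrac_eq0 // => H.
have /eqP := graph_eq (rpred1 G) H.
by rewrite oner_eq0.
Qed.

Lemma cut_length1 : module_length (subquotient I cut) 1.
Proof.
apply: subquotient_length1; first exact: cut_proper.
move=> u v uI vI uC; have [b ub] := Iz uI; have [c vc] := Iz vI.
have b0 : b != 0.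
  by apply: contraNneq uC => b0; apply/cutP; rewrite -b0.
(* As [u / z] and [v / z] have residues [b] and [c], lifting [c / b] makes the residue of
   [(v - a * u) / z] vanish. *)
have [a ra] := res_surj (c / b); exists a; apply/cutP.
have aE : v - a * u = v + (- a) * u by rewrite mulNr.
split; first by rewrite aE idealD // idealM.
have := graphB vc (graphM (GA a) ub).
by rewrite ra divfK // subrr mulrA -mulrBl -rmorphM -rmorphB.
Qed.

(** Dividing by [z ^+ i] gives each of the [i] factors from the cut residue 0. The case [i = 0],
    with arbitrary residue, starts the induction. *)
Lemma cut_pow i a : ideal_pow [set` cut] i a ->
  exists2 b, (frac a / frac z ^+ i, b) \in G & (0 < i)%N -> b = 0.
Proof.
elim: i a => [|i IH] a; first by exists (res a); rewrite // expr0 divr1.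
move=> aC; exists 0 => //; move: a aC; apply: ideal_span_ind.
- by rewrite rmorph0 mul0r; apply: graph0.
- by move=> u v ua vb; rewrite rmorphD mulrDl -[0]addr0; apply: graphD.
move=> c _ [u /cutP[_ uz] [v /IH[b vb _] <-]].
have -> : frac (c * (u * v)) / frac z ^+ i.+1 =
    frac c * (frac u / frac z * (frac v / frac z ^+ i)).
  by rewrite !rmorphM exprS invfM -mulrA mulrACA.
by have := graphM (GA c) (graphM uz vb); rewrite mul0r mulr0.
Qed.

(** Since [I] is integrally closed, [y] lies in [I] and [y / z] has a residue [c]. Dividing the
    integral equation by [z ^+ n] and taking residues kills all terms but the first, leaving
    [c ^+ n = 0]. *)
Lemma cut_integrally_closed :
  integrally_closed_ideal I -> integrally_closed_ideal cut.
Proof.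
move=> Icl y yC.
have yI : y \in I by apply: Icl; apply: integral_over_idealS yC; apply: cut_sub.
have [c yc] := Iz yI; apply/cutP; split=> //.
have [n [a [n0 aC aE]]] := yC.
have fz0 : frac z != 0 by rewrite tofrac_eq0.
have yX i : ((frac y / frac z) ^+ i, c ^+ i) \in G.
  elim: i => [|i IH]; first exact: (rpred1 G).
  by rewrite !exprS; apply: graphM.
have sumG : (\sum_(1 <= i < n.+1)
    frac (a i) / frac z ^+ i * (frac y / frac z) ^+ (n - i), 0) \in G.
  rewrite big_nat; apply: (big_ind (fun w => (w, 0) \in G)) => [|u v ua vb|i].
  - exact: graph0.
  - by have := graphD ua vb; rewrite addr0.
  move=> i_n; have [b ab b0] := cut_pow (aC i i_n).
  have := graphM ab (yX (n - i)%N).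
  by rewrite b0 ?mul0r //; case/andP: i_n.
have cn0 : c ^+ n = 0.
  apply: Gfun; have := graphD (yX n) sumG; rewrite addr0.
  suff -> : (frac y / frac z) ^+ n + \sum_(1 <= i < n.+1)
      frac (a i) / frac z ^+ i * (frac y / frac z) ^+ (n - i) =
      frac (y ^+ n + \sum_(1 <= i < n.+1) a i * y ^+ (n - i)) / frac z ^+ n.
    by rewrite aE rmorph0 mul0r.
  rewrite rmorphD rmorphXn mulrDl expr_div_n rmorph_sum mulr_suml.
  congr (_ + _); apply: eq_big_nat => i /andP[_ le_in].
  rewrite rmorphM rmorphXn expr_div_n mulrACA; congr (_ * _).
  by rewrite -invfM -exprD subnKC.
have -> : 0 = c by apply/esym/eqP; move/eqP: cn0; rewrite expf_eq0 => /andP[].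
exact: yc.
Qed.
End Cut.

Lemma integrally_closed_step I J : GRing.closed_field_axiom k ->
    integrally_closed_ideal I -> integrally_closed_ideal J ->
    {subset J <= I} -> ~ {subset I <= J} ->
  exists I' : ideal A, [/\ {subset J <= I'}, {subset I' <= I},
    ~ {subset I <= I'}, integrally_closed_ideal I' &
    module_length (subquotient I I') 1].
Proof.
move=> k_closed Icl Jcl JI nIJ; have [x xI xJ] := not_subset nIJ.
have x0 : x != 0 by apply: contraNneq xJ => ->; apply: rpred0.
pose G0 := set_subring (@rees_graph1 J x) (@rees_graphB J x) (@rees_graphM J x).
have G0P u : u \in G0 <-> rees_graph J x u by exact: set_subringE.
have G0fun : hom_graph G0 by move=> c /G0P; apply: rees_graph_fun.
have G0surj c : exists y, (y, c) \in G0.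
  by have [a <-] := res_surj c; exists (frac a); apply/G0P/rees_graphC.
have [G [G0G Gfun Gval]] := place_extension k_closed G0fun G0surj.
have GA a : (frac a, res a) \in G by apply/G0G/G0P/rees_graphC.
have [z [zI z0 Iz]] := graph_min_ideal GA Gval xI x0.
exists (cut GA I z); split.
- move=> j jJ; apply/cutP; split; first exact: JI.
  have [b xz] := Iz x xI.
  have /G0P/G0G jx := rees_graph_div x jJ.
  by have := graphM jx xz; rewrite mul0r mulrA divfK // tofrac_eq0.
- exact: cut_sub.
- exact: cut_proper.
- exact: cut_integrally_closed.
- exact: cut_length1.
Qed.
End Step.

(** * Iterating the cut from [I] down to [J] *)

Lemma primary_for_between (R : comPzRingType) (m I J K : ideal R) :
  local_ring m -> primary_for m I -> primary_for m J ->
  {subset J <= K} -> {subset K <= I} -> primary_for m K.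
Proof.
move=> locm [[I1 _] radI] [_ radJ] JK KI.
have radK : (radical K = [set` m])%classic.
  rewrite eqEsubset; split=> x.
    by case=> n /KI xn; rewrite -radI; exists n.
  by rewrite -radJ => -[n /JK xn]; exists n.
(* With radical [m], primality up to radical follows by cancelling [y] outside [m], which is a
   unit. *)
split=> //; split; first by apply: contra I1; apply: KI.
move=> x y xyK xK; rewrite radK /=; apply: contrapT => /negP ym.
have [b by1] := local_ring_unit locm ym.
by case/negP: xK; rewrite -[x]mulr1 -by1 mulrCA idealM.
Qed.

Theorem corollary2p2 (A : idomainType) (m : ideal A)
    (k : fieldType) (res : {rmorphism A -> k}) (I J : ideal A) :
  local_ring m -> excellent A -> normal_domain A ->
  is_residue_field m res -> GRing.closed_field_axiom k ->
  primary_for m I -> integrally_closed_ideal I ->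
  primary_for m J -> integrally_closed_ideal J ->
  {subset J <= I} ->
  exists (l : nat) (I_ : nat -> ideal A),
    [/\ I_ 0%N =i I, I_ l =i J,
        forall i, (i <= l)%N ->
          primary_for m (I_ i) /\ integrally_closed_ideal (I_ i) &
        forall i, (i < l)%N ->
          {subset I_ i.+1 <= I_ i} /\
          module_length (subquotient (I_ i) (I_ i.+1)) 1].
Proof.
move=> locm _ _ resm k_closed + + Jprim Jcl.
have [r r_mono] : exists r, strictly_monotone_above J r.
  apply: (exists_rank locm) => x xm; have [_ radJ] := Jprim.
  have : ([set` m] x)%classic by [].
  by rewrite -radJ.
move=> Iprim Icl JI.
(* The first term is strengthened to an equality of ideals, so that it can be rewritten when another
   ideal is prepended. *)
suff [l [I_ [I0 Il Icls Istep]]] : exists (l : nat) (I_ : nat -> ideal A),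
    [/\ I_ 0%N = I, I_ l =i J,
        forall i, (i <= l)%N ->
          primary_for m (I_ i) /\ integrally_closed_ideal (I_ i) &
        forall i, (i < l)%N ->
          {subset I_ i.+1 <= I_ i} /\
          module_length (subquotient (I_ i) (I_ i.+1)) 1].
  by exists l, I_; split=> //; rewrite I0.
(* Induction on the rank of [I], which drops strictly at each cut. *)
have [N] := ubnP (r I); elim: N => // N IH in I Iprim Icl JI *.
rewrite ltnS => rN; have [IJ|nIJ] := pselect {subset I <= J}.
  exists 0%N, (fun=> I); split=> // x.
  by apply/idP/idP; [apply: IJ | apply: JI].
have [I' [JI' I'I nII' I'cl len1]] :=
  integrally_closed_step locm resm k_closed Icl Jcl JI nIJ.
have I'prim := primary_for_between locm Iprim Jprim JI' I'I.
have [||||l [I_ [I0 Il Icls Istep]]] := IH I' => //.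
  by have [_ /(_ nII') lt_r] := r_mono I I' JI' I'I; apply: leq_trans lt_r rN.
exists l.+1, (fun i => if i is i'.+1 then I_ i' else I); split=> //.
  by case=> [|i] // le_i; apply: Icls.
by case=> [|i] lt_i; [rewrite I0 | apply: Istep].
Qed.
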